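(* Let $(f_{n,k})_{n,k\ge 0}$ be real numbers indexed by two non-negative integers, such that for each $n$ only finitely many $f_{n,k}$ are non-zero. Let $I\ge 1$ be an integer, let $n_1,\dots,n_I$ be non-negative integers and let $a_{ij}$ ($1\le i\le I$, $1\le j\le n_i$) be real numbers such that $$f_{n,k}=\sum_{i=1}^{I}\sum_{j=1}^{n_i}a_{ij}\,f_{n-i,k-j}$$ for all $n\ge I$ and all $k\ge 0$, where $f_{m,l}:=0$ whenever $l<0$. Let $F(x,y)=\sum_{n\ge0}\sum_{k\ge0}f_{n,k}x^ny^k$, let $Q(x,y)=1-\sum_{i=1}^{I}\sum_{j=1}^{n_i}a_{ij}x^iy^j$ and let $P(x,y)=Q(x,y)F(x,y)$ (a polynomial), so that $F=P/Q$. If $Q(x,1)$ has a unique root $\rho$ of smallest modulus, this root has multiplicity $1$, and $P(\rho,1)\neq 0$, then $$\lim_{n\to\infty}\frac{\sum_{k\ge0}k\,f_{n,k}}{n\sum_{k\ge0}f_{n,k}}=\frac{\sum_{i=1}^{I}\sum_{j=1}^{n_i}j\,a_{ij}\rho^i}{\sum_{i=1}^{I}\sum_{j=1}^{n_i}i\,a_{ij}\rho^i}.$$ *)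

(* Defs.v *)
From mathcomp Require Import all_boot all_order all_algebra.
From mathcomp Require Import complex.
From mathcomp Require Import all_classical all_reals all_analysis.

Set Implicit Arguments.
Unset Strict Implicit.
Unset Printing Implicit Defensive.

Import Order.TTheory GRing.Theory Num.Theory.
Import numFieldNormedType.Exports.

Local Open Scope classical_set_scope.
Local Open Scope ring_scope.
Local Open Scope complex_scope.

(* A formal power series in x and y is its coefficient function: A n k is the
   coefficient of x^n y^k.  A polynomial in x and y is an element of
   {poly {poly R}} whose outer variable is x and whose inner variable is y. *)
Definition series2 (R : Type) := nat -> nat -> R.

Definition poly2_series (R : realType) (A : {poly {poly R}}) : series2 R :=
  fun n k => A`_n`_k.

Definition mul_series2 (R : realType) (A B : series2 R) : series2 R :=
  fun n k => \sum_(i < n.+1) \sum_(j < k.+1) A i j * B (n - i)%N (k - j)%N.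

Definition to_complex2 (R : realType) (A : {poly {poly R}}) :
    {poly {poly R[i]}} :=
  map_poly (map_poly (real_complex R)) A.

Definition at_y1 (K : comNzRingType) (A : {poly {poly K}}) : {poly K} :=
  map_poly (horner_eval 1) A.

Definition charQ (R : realType) (I : nat) (d : nat -> nat)
    (a : nat -> nat -> R) : {poly {poly R}} :=
  1 - \sum_(1 <= i < I.+1) \sum_(1 <= j < (d i).+1)
        (a i j *: 'X^j)%:P * 'X^i.

(* The value f m (k - j), read as 0 when k - j is negative. *)
Definition shift0 (R : realType) (f : series2 R) (m k j : nat) : R :=
  if (j <= k)%N then f m (k - j)%N else 0.

Definition linear_rec2 (R : realType) (I : nat) (d : nat -> nat)
    (a : nat -> nat -> R) (f : series2 R) : Prop :=
  forall n k : nat, (I <= n)%N ->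
    f n k = \sum_(1 <= i < I.+1) \sum_(1 <= j < (d i).+1)
              a i j * shift0 f (n - i)%N k j.

Definition unique_min_root (R : realType) (p : {poly R[i]}) (rho : R[i]) :
    Prop :=
  root p rho /\ forall z : R[i], root p z -> z != rho -> `|rho| < `|z|.

Lemma coef_charQ (R : realType) (I : nat) (d : nat -> nat)
    (a : nat -> nat -> R) (n k : nat) :
  (charQ I d a)`_n`_k = ((n == 0%N) && (k == 0%N))%:R
    - \sum_(1 <= i < I.+1) \sum_(1 <= j < (d i).+1)
        a i j * ((n == i) && (k == j))%:R.
Proof.
rewrite /charQ coefB coefB coef1; congr (_ - _).
  by case: (n == 0%N); rewrite ?coef1 ?coef0.
rewrite !coef_sum; apply: eq_bigr => i _; rewrite !coef_sum.
apply: eq_bigr => j _; rewrite coefCM coefXn.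
case: (n == i); rewrite /= ?mulr1 ?mulr0 ?coef0 //.
by rewrite coefZ coefXn.
Qed.

Lemma mul_charQ (R : realType) (I : nat) (d : nat -> nat)
    (a : nat -> nat -> R) (f : series2 R) (n k : nat) :
  mul_series2 (poly2_series (charQ I d a)) f n k = f n k
    - \sum_(1 <= i < I.+1 | (i <= n)%N) \sum_(1 <= j < (d i).+1)
        a i j * shift0 f (n - i)%N k j.
Proof.
have pick (m i : nat) (G : nat -> R) :
    \sum_(p < m.+1) (p == i :> nat)%:R * G p = if (i <= m)%N then G i else 0.
  case: leqP => im.
    rewrite (bigD1 (Ordinal (im : (i < m.+1)%N))) //= eqxx mul1r big1 ?addr0 //.
    by move=> p /negPf pi; rewrite (_ : (p == i :> nat) = false) ?mul0r.
  rewrite big1 // => p _; rewrite (_ : (p == i :> nat) = false) ?mul0r //.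
  by apply/negbTE; rewrite neq_ltn (leq_trans (ltn_ord p) im).
have pick2 (i j : nat) :
    \sum_(p < n.+1) \sum_(q < k.+1) ((p == i :> nat) && (q == j :> nat))%:R
      * f (n - p)%N (k - q)%N = if (i <= n)%N then shift0 f (n - i)%N k j else 0.
  rewrite -(pick n i (fun p => shift0 f (n - p)%N k j)).
  apply: eq_bigr => p _; rewrite /shift0 -(pick k j (fun q => f (n - p)%N (k - q)%N)).
  rewrite mulr_sumr; apply: eq_bigr => q _.
  by case: (p == i :> nat); rewrite /= ?mul1r ?mul0r.
rewrite /mul_series2 /poly2_series.
under eq_bigr do under eq_bigr do rewrite coef_charQ mulrBl.
under eq_bigr do rewrite sumrB.
rewrite sumrB pick2 /= /shift0 /= !subn0; congr (_ - _).
under eq_bigr do under eq_bigr do rewrite mulr_suml.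
under eq_bigr do rewrite exchange_big.
rewrite exchange_big [RHS]big_mkcond; apply: eq_bigr => i _ /=.
under eq_bigr do under eq_bigr do rewrite mulr_suml.
under eq_bigr do rewrite exchange_big.
rewrite exchange_big /=.
transitivity (\sum_(1 <= j < (d i).+1) a i j *
    (if (i <= n)%N then shift0 f (n - i)%N k j else 0)).
  apply: eq_bigr => j _; rewrite -pick2 mulr_sumr; apply: eq_bigr => p _.
  by rewrite mulr_sumr; apply: eq_bigr => q _; rewrite mulrA.
case: ifP => // _; by rewrite big1 // => j _; rewrite mulr0.
Qed.

(* Q F is a polynomial. *)
Lemma charQ_mul_poly (R : realType) (f : series2 R)
    (f_fin : forall n : nat, finite_set [set k : nat | f n k != 0])
    (I : nat) (d : nat -> nat) (a : nat -> nat -> R)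
    (f_rec : linear_rec2 I d a f) :
  exists P : {poly {poly R}}, forall n k : nat,
    poly2_series P n k = mul_series2 (poly2_series (charQ I d a)) f n k.
Proof.
have /boolp.choice[N fN] (n : nat) :
    exists N : nat, forall k : nat, (N <= k)%N -> f n k = 0.
  have /finite_fsetP[X fX] := f_fin n.
  exists (\max_(x <- finmap.enum_fset X) x).+1 => k kX; apply/eqP.
  apply: contraTT kX => fk; rewrite -ltnNge ltnS.
  have kX : k \in finmap.enum_fset X.
    by have : [set k : nat | f n k != 0] k by []; rewrite fX.
  exact: (@leq_bigmax_seq _ _ xpredT id k).
pose q := mul_series2 (poly2_series (charQ I d a)) f.
pose K := (\max_(n < I) N n + \max_(i < I.+1) d i)%N.
exists (\poly_(n < I) \poly_(k < K) q n k) => n k.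
rewrite /poly2_series coef_poly; case: ltnP => nI; last first.
  rewrite coef0 /q mul_charQ (f_rec _ k nI) big_nat_cond [in X in _ - X]big_nat_cond.
  apply/esym/eqP; rewrite subr_eq0; apply/eqP; apply: eq_bigl => i.
  rewrite andbT; case: (1 <= i < I.+1)%N / andP => // -[_ iI].
  by rewrite (leq_trans _ nI).
rewrite coef_poly; case: ltnP => // Kk.
have NK (m : nat) : (m < I)%N -> (N m <= \max_(n < I) N n)%N.
  by move=> mI; exact: (leq_bigmax (Ordinal mI)).
apply/esym; rewrite mul_charQ fN ?sub0r.
  apply/eqP; rewrite oppr_eq0; apply/eqP.
  rewrite big_nat_cond big1 // => i /andP[/andP[i1 iI] _].
  rewrite big_nat_cond big1 // => j /andP[/andP[_ jd] _].
  rewrite /shift0; case: ifP => jk; rewrite ?mulr0 // fN ?mulr0 //.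
  have dK : (d i <= \max_(i < I.+1) d i)%N := leq_bigmax (Ordinal iI).
  have := NK (n - i)%N (leq_ltn_trans (leq_subr _ _) nI).
  move=> /leq_trans; apply; rewrite leq_subRL //.
  apply: leq_trans Kk; rewrite addnC leq_add2l.
  exact: leq_trans dK.
by apply: leq_trans Kk; apply: leq_trans (NK _ nI) (leq_addr _ _).
Qed.

(* Main.v *)
Require Import Defs.
From mathcomp Require Import all_boot all_order all_algebra.
From mathcomp Require Import complex ring.
From mathcomp Require Import all_classical all_reals all_analysis.

Set Implicit Arguments.
Unset Strict Implicit.
Unset Printing Implicit Defensive.

Import Order.TTheory GRing.Theory Num.Theory.
Import numFieldNormedType.Exports.

Local Open Scope classical_set_scope.
Local Open Scope ring_scope.
Local Open Scope complex_scope.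

(** Write [q = Q(x,1)], [p = P(x,1)], [b = - Q_y(x,1)], and let [g], [h] be the
    sequences of row sums and of row sums weighted by [k].  Setting [y = 1] in
    [Q F = P] and in its [y]-derivative gives [q g = p] and
    [q h = P_y(x,1) + b g].  Factor [q = (x - rho) r].  Multiplying a series by
    a linear factor [x - z] with [|z| > |rho|] can be undone without losing
    convergence of the coefficients scaled by [rho^n], because the recurrence
    it encodes is a contraction; hence so can multiplying by [r].  Dividing by
    [x - rho] amounts to taking partial sums, which gives
    [g_n rho^n --> G := - p(rho) / (rho r(rho))] and, by Cesaro,
    [h_n rho^n / n --> - b(rho) G / (rho r(rho))].  The quotient is
    [- b(rho) / (rho r(rho))], where [r(rho) = q'(rho)]. *)

(** * Limits of complex sequences: contractions and Cesaro means *)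

Lemma norm_normc (R : realType) (z : R[i]) : `|z| = (Normc.normc z)%:C.
Proof. by []. Qed.

Lemma normc_ge0 (R : realType) (z : R[i]) : 0 <= Normc.normc z.
Proof. by case: z => x y; exact: sqrtr_ge0. Qed.

(** Moves complex limits to real null sequences, where order arguments apply. *)
Lemma cvg_complexP (R : realType) (u : nat -> R[i]) (l : R[i]) :
  ((u : nat -> (R[i] : numFieldType)) @ \oo --> (l : (R[i] : numFieldType))) <->
  (Normc.normc (l - u n) @[n --> \oo] --> (0 : R)).
Proof.
split=> [/cvgrPdist_lt ul|/cvgrPdist_lt ul].
  apply/cvgrPdist_lt => e e0.
  have {}e0 : 0 < e%:C by rewrite (ltcR 0).
  near=> n; rewrite sub0r normrN ger0_norm ?normc_ge0// -ltcR -norm_normc.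
  by near: n; exact: ul.
apply/cvgrPdist_lt => -[e e'] e0.
(* A radius that is positive in [R[i]] has zero imaginary part. *)
have [/eqP e'0 {}e0] : e' == 0 /\ 0 < e by apply/andP; move: e0; rewrite ltcE.
rewrite {e'}e'0; near=> n; rewrite norm_normc ltcR.
suff: `|0 - Normc.normc (l - u n)| < e.
  by rewrite sub0r normrN ger0_norm ?normc_ge0.
by near: n; exact: ul.
Unshelve. all: by end_near. Qed.

(** Once [h] stays below [(1 - q) * (eps / 2)], a step of the recurrence preserves the excess
    [eps / 2], because [q * (eps / 2) + (1 - q) * (eps / 2) = eps / 2]; the rest decays
    geometrically. *)
Lemma cvg_contract0 (R : realType) (q : R) (e h : nat -> R) :
  0 <= q < 1 -> (forall n, 0 <= e n) ->
  (forall n, e n.+1 <= q * e n + h n) ->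
  h @ \oo --> (0 : R) -> e @ \oo --> (0 : R).
Proof.
move=> /andP[q0 q1] e0 eh /cvgrPdist_lt h0; apply/cvgrPdist_lt => eps eps0.
have d0 : 0 < (1 - q) * (eps / 2) by rewrite mulr_gt0 ?divr_gt0 ?subr_gt0.
have [N _ hN] := h0 _ d0.
have bound m : e (m + N)%N <= q ^+ m * e N + eps / 2.
  elim: m => [|m IH]; first by rewrite expr0 mul1r add0n lerDl ltW ?divr_gt0.
  rewrite addSn; apply: (le_trans (eh _)).
  have /ltW hm : h (m + N)%N < (1 - q) * (eps / 2).
    have := hN (m + N)%N (leq_addl _ _); rewrite /= sub0r normrN.
    by apply: le_lt_trans; exact: ler_norm.
  apply: le_trans (lerD (ler_wpM2l q0 IH) hm) _.
  by rewrite mulrDr mulrA -exprS -addrA -mulrDl addrCA subrr addr0 mul1r.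
have qe : q ^+ m * e N @[m --> \oo] --> (0 : R).
  rewrite -(mul0r (e N)); apply: cvgM; last exact: cvg_cst.
  by apply: cvg_expr; rewrite ger0_norm.
have e20 : 0 < eps / 2 by rewrite divr_gt0.
move/cvgrPdist_lt: qe => /(_ _ e20)[M _ hM].
exists (M + N)%N => // n /= Mn; rewrite sub0r normrN ger0_norm//.
have Nn : (N <= n)%N by apply: leq_trans Mn; exact: leq_addl.
rewrite -(subnK Nn); apply: le_lt_trans (bound _) _.
rewrite {2}(splitr eps) ltrD2r; apply: le_lt_trans (ler_norm _) _.
by have := hM (n - N)%N; rewrite /= sub0r normrN leq_subRL // addnC; apply.
Qed.

(** The limit is the fixed point of [x = c * x + L]; the distance of [u n] to it obeys a real
    contraction inequality with error [L - v n]. *)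
Lemma cvg_contract (R : realType) (c L : R[i]) (u v : nat -> R[i]) :
  `|c| < 1 -> (forall n, u n.+1 = c * u n + v n) ->
  (v : nat -> (R[i] : numFieldType)) @ \oo --> (L : (R[i] : numFieldType)) ->
  (u : nat -> (R[i] : numFieldType)) @ \oo -->
    (L / (1 - c) : (R[i] : numFieldType)).
Proof.
move=> c1 uv /cvg_complexP vL; apply/cvg_complexP.
have c0 : 1 - c != 0.
  by rewrite subr_eq0; apply: contraTneq c1 => <-; rewrite normr1 ltxx.
apply: (@cvg_contract0 _ (Normc.normc c) _ _ _ _ _ vL) => [|n|n].
- by rewrite normc_ge0/= -ltcR -norm_normc.
- exact: normc_ge0.
rewrite -Normc.normcM.
have -> : L / (1 - c) - u n.+1 = c * (L / (1 - c) - u n) + (L - v n).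
  by rewrite uv; field.
exact: le_normcD.
Qed.

Lemma cesaro_complex (R : realType) (u : nat -> R[i]) (l : R[i]) :
  (u : nat -> (R[i] : numFieldType)) @ \oo --> (l : (R[i] : numFieldType)) ->
  ((\sum_(k < n.+1) u k) / n.+1%:R : (R[i] : numFieldType)) @[n --> \oo] -->
    (l : (R[i] : numFieldType)).
Proof.
move=> /cvg_complexP/cesaro ul; apply/cvg_complexP.
apply: squeeze_cvgr ul; last exact: cvg_cst.
apply: nearW => n; rewrite normc_ge0 /= /arithmetic_mean /series /= big_mkord.
have n0 : (n.+1%:R : R[i]) != 0 by rewrite pnatr_eq0.
have -> : l - (\sum_(k < n.+1) u k) / n.+1%:R =
    (\sum_(k < n.+1) (l - u k)) / n.+1%:R.
  by rewrite sumrB sumr_const card_ord -mulr_natr; field.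
rewrite -lecR -norm_normc normrM normfV normr_nat mulrC.
rewrite rmorphM fmorphV rmorph_nat rmorph_sum /=.
by rewrite ler_wpM2l ?invr_ge0 ?ler0n// ler_norm_sum.
Qed.

(** * Cauchy product of a polynomial with a coefficient sequence *)

Definition pconv (K : nzRingType) (p : {poly K}) (u : nat -> K) (n : nat) : K :=
  \sum_(i < n.+1) p`_i * u (n - i)%N.

(** Coefficient [n] sees only [u 0], ..., [u n], so the ring laws of polynomials carry over to
    [pconv]. *)
Lemma pconv_trunc (K : nzRingType) (p : {poly K}) (u : nat -> K) (n N : nat) :
  (n < N)%N -> pconv p u n = (p * \poly_(m < N) u m)`_n.
Proof.
move=> nN; rewrite coefM; apply: eq_bigr => i _.
by rewrite coef_poly (leq_ltn_trans (leq_subr _ _) nN).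
Qed.

Lemma pconvM (K : nzRingType) (p q : {poly K}) (u : nat -> K) :
  pconv (p * q) u =1 pconv p (pconv q u).
Proof.
move=> n; rewrite (pconv_trunc _ _ (ltnSn n)) -mulrA coefM.
by apply: eq_bigr => i _; rewrite -pconv_trunc ?ltnS ?leq_subr.
Qed.

Lemma pconvDl (K : nzRingType) (p q : {poly K}) (u : nat -> K) n :
  pconv (p + q) u n = pconv p u n + pconv q u n.
Proof.
by rewrite /pconv -big_split /=; apply: eq_bigr => i _; rewrite coefD mulrDl.
Qed.

Lemma pconvC (K : nzRingType) (c : K) (u : nat -> K) n :
  pconv c%:P u n = c * u n.
Proof.
by rewrite (pconv_trunc _ _ (ltnSn n)) coefCM coef_poly ltnSn.
Qed.

Lemma pconvX (K : nzRingType) (u : nat -> K) n :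
  pconv 'X u n = if n == 0%N then 0 else u n.-1.
Proof.
rewrite (pconv_trunc _ _ (ltnSn n)) coefXM.
by case: n => //= n; rewrite coef_poly leqW.
Qed.

Lemma pconv_XsubC (K : nzRingType) (z : K) (u : nat -> K) n :
  pconv ('X - z%:P) u n = (if n == 0%N then 0 else u n.-1) - z * u n.
Proof. by rewrite -polyCN pconvDl pconvX pconvC mulNr. Qed.

(** * Coefficient asymptotics on the scale of [rho ^+ n] *)

Section ScaledAsymptotics.
Variables (R : realType) (rho : R[i]).
Hypothesis rho0 : rho != 0.
Let rho0' : - rho != 0. Proof. by rewrite oppr_eq0. Qed.
Local Notation C := (R[i] : numFieldType).

Definition scaled_cvg (u : nat -> R[i]) (L : R[i]) : Prop :=
  (u n * rho ^+ n : C) @[n --> \oo] --> (L : C).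

Lemma eq_scaled_cvg (u v : nat -> R[i]) (L : R[i]) :
  u =1 v -> scaled_cvg u L -> scaled_cvg v L.
Proof. by move=> /funext ->. Qed.

(** Horner induction on [p]: multiplying by ['X] shifts the sequence, which costs one factor [rho]
    in the limit. *)
Lemma scaled_cvg_pconv (p : {poly R[i]}) (u : nat -> R[i]) (L : R[i]) :
  scaled_cvg u L -> scaled_cvg (pconv p u) (p.[rho] * L).
Proof.
elim/poly_ind: p u L => [|p c IH] u L uL.
  rewrite horner0 mul0r; apply: (@eq_scaled_cvg (fun=> 0)).
    by move=> n; rewrite pconvC mul0r.
  rewrite /scaled_cvg.
  under eq_fun do rewrite mul0r.
  exact: cvg_cst.
have uX : scaled_cvg (pconv 'X u) (rho * L).
  rewrite /scaled_cvg -(@cvg_shiftS C).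
  have -> : [sequence pconv 'X u n.+1 * rho ^+ n.+1]_n =
            (fun n => rho * (u n * rho ^+ n)).
    by apply/funext => n; rewrite /= pconvX /= exprS mulrCA.
  by apply: (@cvgM C); [exact: cvg_cst | exact: uL].
have -> : (p * 'X + c%:P).[rho] * L = p.[rho] * (rho * L) + c * L.
  by rewrite hornerMXaddC mulrDl mulrA.
rewrite /scaled_cvg.
under eq_fun do rewrite pconvDl pconvM pconvC mulrDl -mulrA.
apply: (@cvgD C); first exact: (IH _ _ uX).
by apply: (@cvgM C); [exact: cvg_cst | exact: uL].
Qed.

Lemma scaled_cvg_coef (p : {poly R[i]}) : scaled_cvg (fun n => p`_n) 0.
Proof.
apply: (@cvg_near_cst); exists (size p) => // n /= pn.
by rewrite nth_default// mul0r.
Qed.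

(** With [w n = u n * rho ^+ n] and [v = pconv ('X - z%:P) u], the product reads [w n.+1 = (rho / z)
    * w n - z^-1 * (v n.+1 * rho ^+ n.+1)], and [rho / z] has modulus below 1. *)
Lemma scaled_cvg_div_XsubC (z : R[i]) (u : nat -> R[i]) (L : R[i]) :
  `|rho| < `|z| -> scaled_cvg (pconv ('X - z%:P) u) L ->
  scaled_cvg u (L / (rho - z)).
Proof.
move=> rz uL.
have z0 : z != 0 by rewrite -normr_gt0; apply: le_lt_trans rz.
have rz0 : rho - z != 0.
  by rewrite subr_eq0; apply: contraTneq rz => ->; rewrite ltxx.
have -> : L / (rho - z) = - z^-1 * L / (1 - rho / z).
  by field; rewrite rz0 z0 subr_eq0 eq_sym -subr_eq0 rz0.
apply: (@cvg_contract _ _ _ _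
  (fun n => - z^-1 * (pconv ('X - z%:P) u n.+1 * rho ^+ n.+1))) => [|n|].
- by rewrite normrM normfV ltr_pdivrMr ?normr_gt0// mul1r.
- by rewrite pconv_XsubC /= exprS; field.
- apply: (@cvgM C); first exact: cvg_cst.
  by move: uL; rewrite /scaled_cvg -(@cvg_shiftS C).
Qed.

(** Over the algebraically closed [R[i]], [r] splits, and its linear factors are removed one at a
    time. *)
Lemma scaled_cvg_div (r : {poly R[i]}) (u : nat -> R[i]) (L : R[i]) :
  r != 0 -> (forall z, root r z -> `|rho| < `|z|) ->
  scaled_cvg (pconv r u) L -> scaled_cvg u (L / r.[rho]).
Proof.
have [s ->] := closed_field_poly_normal r; move: (lead_coef r) => c {r}.
rewrite scaler_eq0 negb_or => /andP[c0 _] rs.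
have {rs} : {in s, forall z, `|rho| < `|z|}.
  by move=> z zs; apply: rs; rewrite rootZ// root_prod_XsubC.
elim: s u L => [|z s IH] u L zs.
  rewrite big_nil -mul_polyC mulr1 hornerC /scaled_cvg => uL.
  have -> : (fun n => u n * rho ^+ n) =
            (fun n => c^-1 * (pconv c%:P u n * rho ^+ n)).
    by apply/funext => n; rewrite pconvC -mulrA mulKf.
  by rewrite mulrC; apply: (@cvgM C); [exact: cvg_cst | exact: uL].
rewrite big_cons scalerAr => /(eq_scaled_cvg (pconvM _ _ _)).
move=> /(scaled_cvg_div_XsubC (zs _ (mem_head _ _)))/IH; rewrite hornerM.
rewrite hornerXsubC invfM mulrA; apply=> y ys.
by apply: zs; rewrite in_cons ys orbT.
Qed.

(** Telescoping: the term at [m > 0] is [rho] times the difference of [u m.-1 * rho ^+ m.-1] and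
    [u m * rho ^+ m]. *)
Lemma sum_pconv_XsubC (u : nat -> R[i]) n :
  \sum_(m < n.+1) pconv ('X - rho%:P) u m * rho ^+ m = - rho * (u n * rho ^+ n).
Proof.
elim: n => [|n IH]; first by rewrite big_ord1 pconv_XsubC /=; ring.
by rewrite big_ord_recr /= IH pconv_XsubC /= exprS; ring.
Qed.

Lemma scaled_cvg_simple_pole (r p : {poly R[i]}) (u : nat -> R[i]) :
  r != 0 -> (forall z, root r z -> `|rho| < `|z|) ->
  pconv (('X - rho%:P) * r) u =1 (fun n => p`_n) ->
  scaled_cvg u (p.[rho] / (- rho * r.[rho])).
Proof.
move=> r0 rz up; rewrite invfM mulrA; apply: scaled_cvg_div => //.
apply: (@cvg_near_cst); exists (size p) => // n /= pn.
apply: (@mulfI _ (- rho)); first by rewrite oppr_eq0.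
rewrite -sum_pconv_XsubC mulrC divfK ?oppr_eq0//.
rewrite (horner_coef_wide rho (leqW pn)).
by apply: eq_bigr => m _; rewrite -up pconvM.
Qed.

(** Here [r] is divided out first. The telescoped sum then has [n.+1] terms tending to [L /
    r.[rho]], so its mean converges by Cesaro. *)
Lemma scaled_cvg_double_pole (r : {poly R[i]}) (u : nat -> R[i]) (L : R[i]) :
  r != 0 -> (forall z, root r z -> `|rho| < `|z|) ->
  scaled_cvg (pconv (('X - rho%:P) * r) u) L ->
  (u n * rho ^+ n / n.+1%:R : C) @[n --> \oo] -->
    (L / (- rho * r.[rho]) : C).
Proof.
rewrite mulrC => r0 rz /(eq_scaled_cvg (pconvM _ _ _))/(scaled_cvg_div r0 rz).
move=> /cesaro_complex; rewrite invfM mulrCA => uL.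
have -> : (fun n => u n * rho ^+ n / n.+1%:R) = (fun n => (- rho)^-1 *
    ((\sum_(m < n.+1) pconv ('X - rho%:P) u m * rho ^+ m) / n.+1%:R)).
  by apply/funext => n; rewrite sum_pconv_XsubC -[- rho * _ / _]mulrA mulKf.
by apply: (@cvgM C); [exact: cvg_cst | exact: uL].
Qed.

End ScaledAsymptotics.

(** * Evaluation and differentiation in y at y = 1 *)

Definition dy_at1 (K : comNzRingType) (A : {poly {poly K}}) : {poly K} :=
  map_poly (horner_eval 1 \o deriv) A.

Lemma coef_at_y1 (K : comNzRingType) (A : {poly {poly K}}) n :
  (at_y1 A)`_n = (A`_n).[1].
Proof. by rewrite coef_map. Qed.

Lemma coef_dy_at1 (K : comNzRingType) (A : {poly {poly K}}) n :
  (dy_at1 A)`_n = (A`_n)^`().[1].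
Proof. by rewrite coef_map. Qed.

Lemma dy_at1B (K : comNzRingType) (A B : {poly {poly K}}) :
  dy_at1 (A - B) = dy_at1 A - dy_at1 B.
Proof. exact: raddfB. Qed.

Lemma dy_at1_sum (K : comNzRingType) (J : Type) (s : seq J)
    (A : J -> {poly {poly K}}) :
  dy_at1 (\sum_(i <- s) A i) = \sum_(i <- s) dy_at1 (A i).
Proof. exact: raddf_sum. Qed.

Lemma dy_at1_CMXn (K : comNzRingType) (c : {poly K}) n :
  dy_at1 (c%:P * 'X^n) = c^`().[1] *: 'X^n.
Proof.
apply/polyP => m; rewrite coef_dy_at1 coefCM coefZ !coefXn.
by case: eqP; rewrite ?mulr1 ?mulr0 //= deriv0 horner0.
Qed.

Lemma dy_at1_1 (K : comNzRingType) : dy_at1 (1 : {poly {poly K}}) = 0.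
Proof.
by rewrite -[1](mulr1 1) -{2}(expr0 'X) dy_at1_CMXn derivC horner0 scale0r.
Qed.

Lemma pconv_at_y1 (K : comNzRingType) (Q P : {poly {poly K}})
    (F : nat -> {poly K}) :
  pconv Q F =1 (fun n => P`_n) ->
  pconv (at_y1 Q) (fun n => (F n).[1]) =1 (fun n => (at_y1 P)`_n).
Proof.
move=> QF n; rewrite coef_at_y1 -QF horner_sum.
by apply: eq_bigr => i _; rewrite hornerM coef_at_y1.
Qed.

(** Leibniz rule for [Q F = P], solved for the term containing the y-derivative of [F]. *)
Lemma pconv_dy_at1 (K : comNzRingType) (Q P : {poly {poly K}})
    (F : nat -> {poly K}) :
  pconv Q F =1 (fun n => P`_n) ->
  pconv (at_y1 Q) (fun n => (F n)^`().[1]) =1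
  (fun n => (dy_at1 P)`_n - pconv (dy_at1 Q) (fun n => (F n).[1]) n).
Proof.
move=> QF n; rewrite coef_dy_at1 -QF raddf_sum horner_sum /= -sumrB.
apply: eq_bigr => i _.
by rewrite derivM hornerD !hornerM coef_at_y1 coef_dy_at1 addrAC subrr add0r.
Qed.

(** * The two sums of the limit as derivatives of Q *)

Lemma to_complex2_charQ (R : realType) I d (a : nat -> nat -> R) :
  to_complex2 (charQ I d a) = 1 - \sum_(1 <= i < I.+1) \sum_(1 <= j < (d i).+1)
    ((a i j)%:C *: 'X^j)%:P * 'X^i.
Proof.
rewrite /to_complex2 /charQ rmorphB rmorph1 rmorph_sum; congr (_ - _).
apply: eq_bigr => i _; rewrite rmorph_sum; apply: eq_bigr => j _.
by rewrite rmorphM /= map_polyC map_polyXn /= map_polyZ map_polyXn.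
Qed.

Lemma at_y1_charQ (R : realType) I d (a : nat -> nat -> R) :
  at_y1 (to_complex2 (charQ I d a)) =
  1 - \sum_(1 <= i < I.+1) \sum_(1 <= j < (d i).+1) (a i j)%:C *: 'X^i.
Proof.
rewrite to_complex2_charQ /at_y1 rmorphB rmorph1 rmorph_sum; congr (_ - _).
apply: eq_bigr => i _; rewrite rmorph_sum; apply: eq_bigr => j _.
rewrite rmorphM /= map_polyC map_polyXn /= /horner_eval hornerZ hornerXn.
by rewrite expr1n mulr1 mul_polyC.
Qed.

(** The factor [rho] restores the exponent lowered by differentiation, which uses [1 <= i]; the sign
    undoes the minus in [charQ]. *)
Lemma rho_deriv_charQ (R : realType) I d (a : nat -> nat -> R) (rho : R[i]) :
  - rho * (at_y1 (to_complex2 (charQ I d a)))^`().[rho] =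
  \sum_(1 <= i < I.+1) \sum_(1 <= j < (d i).+1) i%:R * (a i j)%:C * rho ^+ i.
Proof.
rewrite at_y1_charQ derivB derivC sub0r raddf_sum hornerN horner_sum mulrNN.
rewrite mulr_sumr; apply: eq_big_nat => i /andP[i1 _].
rewrite raddf_sum horner_sum mulr_sumr; apply: eq_bigr => j _ /=.
rewrite derivZ derivXn hornerZ hornerMn hornerXn -mulr_natl.
by case: i i1 => // i _; rewrite exprS /=; ring.
Qed.

Lemma dy_at1_charQ (R : realType) I d (a : nat -> nat -> R) (rho : R[i]) :
  - (dy_at1 (to_complex2 (charQ I d a))).[rho] =
  \sum_(1 <= i < I.+1) \sum_(1 <= j < (d i).+1) j%:R * (a i j)%:C * rho ^+ i.
Proof.
rewrite to_complex2_charQ dy_at1B dy_at1_1 sub0r hornerN opprK dy_at1_sum.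
rewrite horner_sum; apply: eq_bigr => i _.
rewrite dy_at1_sum horner_sum; apply: eq_bigr => j _.
rewrite dy_at1_CMXn derivZ derivXn !hornerZ hornerXn hornerMn hornerXn.
by rewrite expr1n [_ * j%:R]mulrC.
Qed.

(** * Row sums as values at 1 of row polynomials *)

Lemma fsum_coef (R : pzSemiRingType) (w : nat -> R) (p : nat -> R) n :
  (forall k, (n <= k)%N -> p k = 0) ->
  \sum_(k \in [set: nat]) w k * p k = \sum_(k < n) w k * p k.
Proof.
move=> p0; rewrite (fsbig_ord _ n (fun k => w k * p k)).
apply/esym/fsbig_widen => // k [_ /negP]; rewrite -leqNgt => nk.
by rewrite /= p0 ?mulr0.
Qed.

Lemma fsum_coef_horner1 (R : comNzRingType) (p : {poly R}) :
  \sum_(k \in [set: nat]) p`_k = p.[1].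
Proof.
under eq_fsbigr do rewrite -[p`__]mul1r.
rewrite (@fsum_coef _ (fun=> 1) _ (size p)) => [|k pk]; last exact: nth_default.
by rewrite horner_coef; apply: eq_bigr => k _; rewrite expr1n mulr1 mul1r.
Qed.

Lemma fsum_coef_deriv1 (R : comNzRingType) (p : {poly R}) :
  \sum_(k \in [set: nat]) k%:R * p`_k = p^`().[1].
Proof.
rewrite (@fsum_coef _ (fun k => k%:R) _ (size p)) => [|k pk]; last first.
  exact: nth_default.
rewrite -[in RHS](coefK p) poly_def raddf_sum horner_sum.
apply: eq_bigr => k _ /=; rewrite derivZ derivXn hornerZ hornerMn hornerXn.
by rewrite expr1n mulrC.
Qed.

Lemma finite_rows_poly (R : realType) (f : nat -> nat -> R) :
  (forall n, finite_set [set k | f n k != 0]) ->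
  exists F : nat -> {poly R}, forall n k, (F n)`_k = f n k.
Proof.
move=> f_fin.
suff /boolp.choice[F FE] : forall n, exists p : {poly R}, forall k,
    p`_k = f n k by exists F.
move=> n; have /finite_fsetP[X fX] := f_fin n.
pose N := (\max_(x <- finmap.enum_fset X) x).+1.
exists (\poly_(k < N) f n k) => k; rewrite coef_poly; case: ltnP => // Nk.
apply/esym/eqP; apply: contraTT Nk => fk; rewrite -ltnNge ltnS.
have kX : k \in finmap.enum_fset X.
  by have : [set k : nat | f n k != 0] k by []; rewrite fX.
exact: (@leq_bigmax_seq _ _ xpredT id k).
Qed.

(** Reading each row as a polynomial in y absorbs the inner convolution into polynomial
    multiplication, leaving a single convolution in x. *)
Lemma pconv_to_complex2 (R : realType) (Q P : {poly {poly R}})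
    (F : nat -> {poly R}) :
  (forall n k, poly2_series P n k =
     mul_series2 (poly2_series Q) (fun n k => (F n)`_k) n k) ->
  pconv (to_complex2 Q) (fun n => map_poly (real_complex R) (F n)) =1
  (fun n => (to_complex2 P)`_n).
Proof.
move=> PQ n; have -> : (to_complex2 P)`_n = map_poly (real_complex R) P`_n.
  by rewrite coef_map.
have -> : P`_n = pconv Q F n.
  apply/polyP => k; rewrite [LHS]PQ coef_sum.
  by apply: eq_bigr => i _; rewrite coefM.
rewrite rmorph_sum; apply: eq_bigr => i _.
by rewrite rmorphM coef_map.
Qed.

Lemma horner_at1_real_complex (R : realType) (p : {poly R}) :
  (map_poly (real_complex R) p).[1] = (p.[1])%:C.
Proof. by rewrite -[1 in LHS](rmorph1 (real_complex R)) horner_map. Qed.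

(** If the cofactor also vanished at [x], then [('X - x%:P) ^+ 2] would divide [q], against
    multiplicity 1. *)
Lemma simple_root_factor (K : fieldType) (q : {poly K}) (x : K) :
  mup x q = 1%N ->
  exists r, [/\ q = ('X - x%:P) * r, r.[x] = q^`().[x] & r.[x] != 0].
Proof.
move=> qx.
have q0 : q != 0.
  apply: contra_eq_neq qx => ->; rewrite neq_ltn.
  (* [mup x 0] is an ordinal below [(size 0).+1 = 1], hence 0. *)
  suff: (mup x (0%R : {poly K}) < (size (0%R : {poly K})).+1)%N.
    by rewrite size_poly0 => ->.
  exact: ltn_ord.
have /factor_theorem[r qr] : root q x.
  by rewrite -dvdp_XsubCl XsubC_dvd// qx.
have rq : r.[x] = q^`().[x].
  rewrite qr derivM derivXsubC hornerD !hornerM hornerXsubC subrr mulr0 add0r.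
  by rewrite hornerC mulr1.
exists r; split=> //; first by rewrite mulrC.
apply: contra_eq_neq qx => rx0.
have /factor_theorem[s rs] : root r x by apply/eqP.
have : (2 <= mup x q)%N by rewrite mup_geq// qr rs -mulrA -expr2 dvdp_mull.
by case: (mup x q) => [|[]].
Qed.

(** * Limits for the two row sums and for their quotient *)

Theorem theorem1 (R : realType) (f : nat -> nat -> R)
    (f_fin : forall n : nat, finite_set [set k : nat | f n k != 0])
    (I : nat) (I_ge1 : (1 <= I)%N) (d : nat -> nat) (a : nat -> nat -> R)
    (f_rec : linear_rec2 I d a f)
    (P : {poly {poly R}})
    (P_def : forall n k : nat,
      poly2_series P n k = mul_series2 (poly2_series (charQ I d a)) f n k)
    (rho : R[i])
    (rho_min : unique_min_root (at_y1 (to_complex2 (charQ I d a))) rho)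
    (rho_simple : mup rho (at_y1 (to_complex2 (charQ I d a))) = 1%N)
    (P_rho : (at_y1 (to_complex2 P)).[rho] != 0) :
  [/\ \forall n \near \oo, \sum_(k \in [set: nat]) f n k != 0,
      \sum_(1 <= i < I.+1) \sum_(1 <= j < (d i).+1)
        i%:R * (a i j)%:C * rho ^+ i != 0
    & (fun n : nat =>
         ((\sum_(k \in [set: nat]) k%:R * f n k)
            / (n%:R * \sum_(k \in [set: nat]) f n k))%:C
         : (R[i] : numFieldType)) @ \oo
      --> ((\sum_(1 <= i < I.+1) \sum_(1 <= j < (d i).+1)
              j%:R * (a i j)%:C * rho ^+ i)
           / (\sum_(1 <= i < I.+1) \sum_(1 <= j < (d i).+1)
                i%:R * (a i j)%:C * rho ^+ i) : (R[i] : numFieldType))].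
Proof.
have [F fF] := finite_rows_poly f_fin.
have {}fF : f = fun n k => (F n)`_k by apply/funext => n; apply/funext => k.
subst f.
rewrite -rho_deriv_charQ -dy_at1_charQ.
have QF := pconv_to_complex2 P_def.
set Fc := (fun n => map_poly (real_complex R) (F n)) in QF.
have g_rec := pconv_at_y1 QF; have h_rec := pconv_dy_at1 QF.
have gE n : (Fc n).[1] = (\sum_(k \in [set: nat]) (F n)`_k)%:C.
  by rewrite fsum_coef_horner1 horner_at1_real_complex.
have hE n : (Fc n)^`().[1] = (\sum_(k \in [set: nat]) k%:R * (F n)`_k)%:C.
  by rewrite fsum_coef_deriv1 deriv_map horner_at1_real_complex.
set q := at_y1 (to_complex2 (charQ I d a)) in rho_min rho_simple g_rec h_rec *.
set p := at_y1 (to_complex2 P) in P_rho g_rec.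
(* This [b] is [Q_y(x,1)] itself, opposite in sign to the b of the overview. *)
set b := dy_at1 (to_complex2 (charQ I d a)) in h_rec *.
set g := (fun n => (Fc n).[1]) in g_rec h_rec.
set h := (fun n => (Fc n)^`().[1]) in h_rec.
have [r [qr rq rrho0]] := simple_root_factor rho_simple.
rewrite -rq.
(* All exponents [i] are at least 1, so [q] takes the value 1 at 0. *)
have rho0 : rho != 0.
  have [rho_root _] := rho_min; apply: contraTneq rho_root => ->.
  rewrite /root /q at_y1_charQ hornerD hornerN hornerC horner_sum.
  rewrite big_nat big1 ?subr0 ?oner_eq0// => i /andP[i1 _].
  rewrite horner_sum big1// => j _.
  by rewrite hornerZ hornerXn expr0n gtn_eqF ?mulr0.
have r0 : r != 0 by apply: contraNneq rrho0 => ->; rewrite horner0.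
have rz z : root r z -> `|rho| < `|z|.
  move=> rz; apply: rho_min.2; first by rewrite qr rootM rz orbT.
  by apply: contraNneq rrho0 => <-.
have den0 : - rho * r.[rho] != 0 by rewrite mulf_neq0 ?oppr_eq0.
rewrite qr in g_rec h_rec.
have gG := scaled_cvg_simple_pole rho0 r0 rz g_rec.
set G := _ / _ in gG.
have G0 : G != 0 by rewrite mulf_neq0 ?invr_neq0.
(* In the equation for [h], the polynomial [P_y(x,1)] contributes 0 in the limit, and convolving [g]
   with [b] multiplies its limit [G] by [b.[rho]]. *)
have hH : ((h n * rho ^+ n / n.+1%:R : (R[i] : numFieldType)) @[n --> \oo] -->
    ((- b.[rho] * G) / (- rho * r.[rho]) : (R[i] : numFieldType))).
  apply: (scaled_cvg_double_pole rho0 r0 rz).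
  apply: (eq_scaled_cvg (fsym h_rec)).
  rewrite /scaled_cvg mulNr -sub0r.
  under eq_fun do rewrite mulrBl.
  apply: (@cvgB (R[i] : numFieldType)); first exact: scaled_cvg_coef.
  exact: scaled_cvg_pconv.
have gN0 : \forall n \near \oo, g n * rho ^+ n != 0 := cvgr_neq0 _ gG G0.
split; [| exact: den0 |].
  near=> n.
  have : g n * rho ^+ n != 0 by near: n; exact: gN0.
  by apply: contraNneq => g0; rewrite /g gE g0 rmorph0 mul0r.
(* Corrects the Cesaro denominator [n.+1] to the [n] of the conclusion. *)
pose s n : R[i] := n.+1%:R / n%:R.
have s1 :
    (s : nat -> (R[i] : numFieldType)) @ \oo --> (1 : (R[i] : numFieldType)).
  rewrite -(@cvg_shiftS (R[i] : numFieldType)); apply/cvg_complexP.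
  have -> : (fun n => Normc.normc (1 - s n.+1)) = @harmonic R.
    apply/funext => n; apply: complexI; rewrite -norm_normc /s.
    have n0 : (n.+1%:R : R[i]) != 0 by rewrite pnatr_eq0.
    have -> : 1 - n.+2%:R / n.+1%:R = - (n.+1%:R^-1) :> R[i].
      by rewrite -[n.+2%:R]natr1 mulrDl divff// mul1r opprD addrA subrr sub0r.
    by rewrite normrN normfV normr_nat fmorphV rmorph_nat.
  exact: cvg_harmonic.
have -> : - b.[rho] / (- rho * r.[rho]) =
   1 * (- b.[rho] * G / (- rho * r.[rho]) * G^-1).
  by rewrite mul1r mulrAC mulfK.
have : (s n * (h n * rho ^+ n / n.+1%:R * (g n * rho ^+ n)^-1)
    : (R[i] : numFieldType)) @[n --> \oo] -->
   (1 * (- b.[rho] * G / (- rho * r.[rho]) * G^-1) : (R[i] : numFieldType)).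
  apply: (@cvgM (R[i] : numFieldType)); first exact: s1.
  apply: (@cvgM (R[i] : numFieldType)); first exact: hH.
  apply: (@cvgV (R[i] : numFieldType)); [exact: G0 | exact: gG].
(* The terms agree for every [n]: only [rho ^+ n] and [n.+1%:R] are cancelled, while the inverses of
   [n%:R] and [g n] stay untouched, even where they are 0 by default. *)
apply: cvg_trans; apply: near_eq_cvg; apply: nearW => n.
have rn0 : rho ^+ n != 0 by rewrite expf_neq0.
have n0 : (n.+1%:R : R[i]) != 0 by rewrite pnatr_eq0.
rewrite rmorphM fmorphV rmorphM rmorph_nat /= -gE -hE -/(g n) -/(h n) /s.
rewrite !invfM.
have -> : n.+1%:R / n%:R * (h n * rho ^+ n / n.+1%:R * ((g n)^-1 / rho ^+ n)) =
    (n.+1%:R / n.+1%:R) * (rho ^+ n / rho ^+ n) * (h n * (n%:R^-1 * (g n)^-1)).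
  by ring.
by rewrite !divff// !mul1r.
Unshelve. all: by end_near. Qed.
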